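(* Let $f$ and $g$ be $C^2$ real-valued functions defined on an open subset of $\mathbb{R}^{N\times N}$ containing $SO(N)$. Let $Q=(q_{ij})_{1\le i,j\le N}$ be a Haar-distributed random element of $SO(N)$ and write $f,g$ for $f(Q),g(Q)$. Then, with all indices running from $1$ to $N$, $$\mathbb{E}\Big(\sum_{i,k}q_{ik}\frac{\partial f}{\partial q_{ik}}g\Big)=\frac{1}{N-1}\mathbb{E}\Big(\sum_{i,k}\frac{\partial^2 f}{\partial q_{ik}^2}g-\sum_{i,j,k,k'}q_{jk}q_{ik'}\frac{\partial^2 f}{\partial q_{ik}\partial q_{jk'}}g+\sum_{i,k}\frac{\partial f}{\partial q_{ik}}\frac{\partial g}{\partial q_{ik}}-\sum_{i,j,k,k'}q_{jk}q_{ik'}\frac{\partial f}{\partial q_{ik}}\frac{\partial g}{\partial q_{jk'}}\Big).$$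
   Context: $\mathbb{R}^{N\times N}$ carries the Euclidean topology; partial derivatives are with respect to the matrix entries, evaluated at $Q$. *)

(* Defs.v *)
From HB Require Import structures.
From mathcomp Require Import all_boot all_order all_algebra.
From mathcomp Require Import all_classical all_reals all_analysis.
Set Implicit Arguments. Unset Strict Implicit. Unset Printing Implicit Defensive.
Import Order.TTheory GRing.Theory Num.Theory.
Import numFieldNormedType.Exports.
Local Open Scope classical_set_scope.
Local Open Scope ring_scope.

Definition SOset (R : realType) (N : nat) : set 'M[R]_N :=
  [set A | A^T *m A = 1%:M /\ \det A = 1].

Definition pderiv (R : realType) (N : nat) (f : 'M[R]_N -> R)
  (i k : 'I_N) (A : 'M[R]_N) : R := 'D_(delta_mx i k) f A.

Definition C2on (R : realType) (N : nat) (D : set 'M[R]_N)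
  (f : 'M[R]_N -> R) : Prop :=
  (forall A, D A -> {for A, continuous f}) /\
  (forall i k A, D A -> derivable f A (delta_mx i k)) /\
  (forall i k A, D A -> {for A, continuous (pderiv f i k)}) /\
  (forall i k j l A, D A -> derivable (pderiv f i k) A (delta_mx j l)) /\
  (forall i k j l A, D A -> {for A, continuous (pderiv (pderiv f i k) j l)}).

(* Q : Omega -> 'M_N is a Haar-distributed random element of SO(N) on the
   probability space (Omega, P): its entries are measurable, it takes values in
   SO(N), and its law is invariant under left multiplication by every element
   of SO(N) (tested against all continuous functions, which determine the law
   of a random element of the compact metric space SO(N)).  A left-invariant
   probability measure on the compact group SO(N) is its Haar measure. *)
Definition haar_SO (R : realType) (N : nat) (d : measure_display)
  (Omega : measurableType d) (P : probability Omega R)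
  (Q : Omega -> 'M[R]_N) : Prop :=
  (forall i j, measurable_fun setT (fun w => Q w i j)) /\
  (forall w, @SOset R N (Q w)) /\
  (forall U : 'M[R]_N, @SOset R N U ->
     forall h : 'M[R]_N -> R, continuous h ->
       (\int[P]_w (h (U *m Q w))%:E = \int[P]_w (h (Q w))%:E)%E).

(* Main.v *)
Require Import Defs.
From HB Require Import structures.
From mathcomp Require Import all_boot all_order all_algebra.
From mathcomp Require Import all_classical all_reals all_analysis.
From mathcomp Require Import measurable_realfun ring.
Set Implicit Arguments. Unset Strict Implicit. Unset Printing Implicit Defensive.
Import Order.TTheory GRing.Theory Num.Theory.
Import numFieldNormedType.Exports.
Local Open Scope classical_set_scope.
Local Open Scope ring_scope.

(** For [i <> j] let [X = E_ij - E_ji] generate the rotations of the [(i, j)]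
    coordinate plane and let [L_ij F A] be the derivative of [F] at [A] in the
    direction [X A].  Since the law of [Q] is invariant under left rotations,
    [E (L_ij F (Q)) = 0].  Take [F = g * L_ij f] and sum over all ordered pairs
    [i <> j].  Because the columns of [Q] are orthonormal, the terms with two
    derivatives contract to twice the bracket on the right-hand side; the
    derivatives falling on the coefficients of [L_ij] contribute
    [- 2 (N - 1) g * sum_ik q_ik (d f / d q_ik)]. *)

(** * Continuity of finite sums, finite products and matrix-valued maps *)

Lemma continuous_at_sum {R : realType} {T : topologicalType} {I : finType}
    (F : I -> T -> R) (t : T) :
  (forall i, {for t, continuous (F i)}) ->
  {for t, continuous (fun x => \sum_i F i x)}.
Proof.
move=> cF; rewrite /prop_for /continuous_at; apply: cvg_big => [|i _].
  exact: add_continuous.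
exact: cF.
Qed.

Lemma continuous_at_prod {R : realType} {T : topologicalType} {I : finType}
    (F : I -> T -> R) (t : T) :
  (forall i, {for t, continuous (F i)}) ->
  {for t, continuous (fun x => \prod_i F i x)}.
Proof.
move=> cF; rewrite /prop_for /continuous_at; apply: cvg_big => [|i _].
  exact: mul_continuous.
exact: cF.
Qed.

Lemma mx_continuous_at {R : realType} {m n : nat} {T : topologicalType}
    (u : T -> 'M[R]_(m, n)) (t : T) :
  (forall i j, {for t, continuous (fun x => u x i j)}) -> {for t, continuous u}.
Proof.
move=> cu; apply/cvgrPdist_le => e e0; near=> x.
rewrite [leLHS]/Num.Def.normr/= mx_normrE (bigmax_le _ (ltW e0))//= => i _.
rewrite !mxE; move: i; near: x; apply: filter_forall => -[i j] /=.
by have /cvgrPdist_le/(_ e e0) := cu i j.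
Unshelve. all: by end_near. Qed.

Lemma mx_entry_le_norm {R : realType} {m n : nat} (A : 'M[R]_(m, n)) i j :
  `|A i j| <= `|A|.
Proof.
rewrite [leRHS]/Num.Def.normr/= mx_normrE.
exact: (le_bigmax _ (fun ij => `|A ij.1 ij.2|) (i, j)).
Qed.

Lemma mulmx_continuous {R : realType} {m n p : nat} (B : 'M[R]_(m, n)) :
  continuous (mulmx B : 'M[R]_(n, p) -> 'M[R]_(m, p)).
Proof.
move=> A; apply: mx_continuous_at => i j.
rewrite (_ : (fun x => _) = fun x : 'M[R]_(n, p) => \sum_k B i k * x k j); last first.
  by apply/funext => x; rewrite mxE.
apply: continuous_at_sum => k; apply: continuousM.
  exact: cst_continuous.
exact: coord_continuous.
Qed.

(** * Compactness of [SO(N)] and extension of continuous functions from it *)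

Section special_orthogonal.
Context {R : realType} {N : nat}.
Implicit Types A : 'M[R]_N.

Lemma SO_mulmx A B : SOset A -> SOset B -> SOset (A *m B).
Proof.
case=> Ao Ad [Bo Bd]; split; last by rewrite det_mulmx Ad Bd mulr1.
by rewrite trmx_mul mulmxA -(mulmxA _ _ A) Ao mulmx1.
Qed.

(** Column [j] is a unit vector, so the square of each of its entries is at most 1. *)
Lemma SO_entry_le1 A i j : SOset A -> `|A i j| <= 1.
Proof.
case=> /matrixP/(_ j j) + _; rewrite !mxE eqxx mulr1n => AA.
rewrite -(@ler_pXn2r _ 2)// ?nnegrE// expr1n real_normK ?num_real// -AA.
rewrite (bigD1 i)//= mxE -expr2 lerDl sumr_ge0// => k _.
by rewrite mxE -expr2 sqr_ge0.
Qed.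

Lemma det_continuous : continuous (determinant : 'M[R]_N -> R).
Proof.
move=> A; rewrite /determinant; apply: continuous_at_sum => s.
apply: continuousM; first exact: cst_continuous.
apply: continuous_at_prod => i; exact: coord_continuous.
Qed.

Lemma SO_closed : closed (@SOset R N).
Proof.
have -> : @SOset R N = ((fun A => A^T *m A) @^-1` [set 1%:M]) `&`
    (determinant @^-1` [set 1]) by [].
apply: closedI.
  apply: preimage_closed; last exact/accessible_closed_set1/hausdorff_accessible/norm_hausdorff.
  move=> A _; apply: mx_continuous_at => i j.
  rewrite (_ : (fun x => _) = fun x : 'M[R]_N => \sum_k x k i * x k j); last first.
    by apply/funext => x; rewrite mxE; apply: eq_bigr => k _; rewrite mxE.
  by apply: continuous_at_sum => k; apply: continuousM; exact: coord_continuous.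
apply: preimage_closed; last exact/accessible_closed_set1/hausdorff_accessible/norm_hausdorff.
by move=> A _; exact: det_continuous.
Qed.

(** Compactness of a product of segments is used for row vectors, so the closed set [SO(N)] is
    placed inside the image of the cube [[-1, 1]^(N * N)] under [vec_mx]. *)
Lemma SO_compact : compact (@SOset R N).
Proof.
have box : compact [set v : 'rV[R]_(N * N) | forall i, `[(-1), 1]%classic (v ord0 i)].
  apply: (@rV_compact R (N * N) (fun=> `[(-1), 1]%classic)) => _.
  exact: segment_compact.
apply: (subclosed_compact SO_closed (@continuous_compact _ _ (@vec_mx R N N) _ _ box) _).
  apply: continuous_subspaceT => v; apply: mx_continuous_at => i j.
  rewrite (_ : (fun x => _) = fun x : 'rV[R]_(N * N) => x 0 (mxvec_index i j)).
    exact: coord_continuous.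
  by apply/funext => x; rewrite mxE.
move=> A SOA; exists (mxvec A); last by rewrite mxvecK.
move=> i; case/mxvec_indexP: i => i j; rewrite mxvecE /= in_itv/= -ler_norml.
exact: SO_entry_le1.
Qed.

Lemma SO_bounded (F : 'M[R]_N -> R) : {within @SOset R N, continuous F} ->
  exists2 M, 0 < M & forall A, SOset A -> `|F A| <= M.
Proof.
move=> cF; have := compact_bounded (continuous_compact cF SO_compact).
move=> /ex_strict_bound_gt0[M M0 FM]; exists M => // A SOA.
by apply/ltW/FM; exists A.
Qed.

(** Tietze extension. It bridges a gap in domains: [haar_SO] tests invariance against functions
    continuous on all matrices, while the functions at hand are controlled only on [SO(N)]. *)
Lemma SO_extension (F : 'M[R]_N -> R) : {within @SOset R N, continuous F} ->
  exists2 h : 'M[R]_N -> R, continuous h & forall A, SOset A -> F A = h A.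
Proof.
move=> cF; have [M M0 FM] := SO_bounded cF.
have [h [Fh ch _]] := continuous_bounded_extension pseudometric_normal SO_closed
  M0 cF FM.
by exists h => // A SOA; apply: Fh; rewrite inE.
Qed.

End special_orthogonal.

(** * Measurability and integrability of functions of a random matrix *)

Lemma measurable_floor_eq {d} {T : measurableType d} {R : realType} (X : T -> R) (z : int) :
  measurable_fun setT X -> measurable [set w | Num.floor (X w) = z].
Proof.
move=> mX.
have -> : [set w | Num.floor (X w) = z] = X @^-1` `[z%:~R, (z + 1)%:~R[.
  apply/seteqP; split=> w /=; rewrite in_itv/=.
    by move=> <-; rewrite floor_le /= floorD1_gt.
  by move=> Xz; apply/eqP; rewrite floor_eq // num_real.
by rewrite -[X in measurable X]setTI; apply: mX => //; exact: measurable_itv.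
Qed.

Lemma measurable_continuous_mx {d} {T : measurableType d} {R : realType} {m n : nat}
    (h : 'M[R]_(m, n) -> R) (Q : T -> 'M[R]_(m, n)) :
  continuous h -> (forall i j, measurable_fun setT (fun w => Q w i j)) ->
  measurable_fun setT (h \o Q).
Proof.
move=> ch mQ.
(* [h \o Q] is the limit of its values at the matrices of entries rounded down
   to multiples of [1 / (k + 1)], which take countably many values. *)
pose fl k w : 'M[int]_(m, n) := \matrix_(i, j) Num.floor (k.+1%:R * Q w i j).
pose gr k (Z : 'M[int]_(m, n)) : 'M[R]_(m, n) := \matrix_(i, j) ((Z i j)%:~R / k.+1%:R).
apply/measurable_EFinP.
apply: (emeasurable_fun_cvg (fun k => EFin \o (h \o gr k \o fl k))) => [k|w _].
  apply/measurable_EFinP.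
  move=> _ Y mY; rewrite setTI.
  have -> : (h \o gr k \o fl k) @^-1` Y =
      \bigcup_(Z in [set Z | Y (h (gr k Z))]) [set w | fl k w = Z].
    apply/seteqP; split => [w /= Yw|w [Z /= YZ ZE]].
      by exists (fl k w).
    by rewrite /= ZE.
  rewrite bigcup_mkcond; apply: countable_bigcupT_measurable => [|Z].
    exact: countableP.
  case: ifP => _ //.
  have -> : [set w | fl k w = Z] =
      \bigcap_(ij in [set: 'I_m * 'I_n])
        [set w | Num.floor (k.+1%:R * Q w ij.1 ij.2) = Z ij.1 ij.2].
    apply/seteqP; split => [w /= <- ij _ /=|w /= H]; first by rewrite mxE.
    by apply/matrixP => i j; rewrite mxE; exact: (H (i, j)).
  apply: fin_bigcap_measurable => // ij _; apply: measurable_floor_eq.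
  exact: measurable_funM.
have hQ : h (gr k (fl k w)) @[k --> \oo] --> h (Q w); last first.
  by apply: cvg_EFin; [exact: nearW|exact: hQ].
apply: continuous_cvg; first exact: ch.
apply/cvgrPdist_le => e e0; near=> k.
rewrite [leLHS]/Num.Def.normr/= mx_normrE (bigmax_le _ (ltW e0))//= => -[i j] _.
rewrite !mxE /=.
have k0 : 0 < k.+1%:R :> R by rewrite ltr0n.
set y := _ * Q w i j.
have -> : Q w i j = y / k.+1%:R by rewrite /y mulrAC divff ?mul1r// lt0r_neq0.
rewrite -mulrBl normrM [`|_^-1|]gtr0_norm ?invr_gt0// ler_pdivrMr//.
(* Rounding down moves [y] by at most 1, so the entry moves by at most [1 / (k + 1)], which is
   eventually below [e]. *)
have : `|y - (Num.floor y)%:~R| <= 1.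
  have /andP[y0 y1] := floor_itv y.
  by rewrite ger0_norm ?subr_ge0// lerBlDl; rewrite intrD in y1; exact: ltW.
move=> /le_trans; apply; rewrite -ler_pdivrMl// mulr1 ltW//.
rewrite -invf_plt ?posrE//; near: k; exact: (near_infty_natSinv_lt (PosNum e0)).
Unshelve. all: by end_near. Qed.

(** Compactness of [SO(N)] bounds [F], and along [Q] it coincides with a globally continuous
    extension, which gives measurability. *)
Lemma SO_random_integrable {d} {T : measurableType d} {R : realType}
    (P : probability T R) {N : nat} (Q : T -> 'M[R]_N) (F : 'M[R]_N -> R) :
  (forall i j, measurable_fun setT (fun w => Q w i j)) -> (forall w, SOset (Q w)) ->
  {within @SOset R N, continuous F} ->
  P.-integrable setT (fun w => (F (Q w))%:E).
Proof.
move=> mQ SOQ cF; apply: measurable_bounded_integrable => //.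
- by rewrite (le_lt_trans (probability_le1 _ _))// ltry.
- have [h ch Fh] := SO_extension cF.
  rewrite (_ : (fun w => _) = h \o Q); first exact: measurable_continuous_mx.
  by apply/funext => w /=; rewrite Fh.
have [M M0 FM] := SO_bounded cF; exists M; split; first exact: num_real.
by move=> x Mx w _ /=; rewrite (le_trans (FM _ (SOQ w)))// ltW.
Qed.

(** * Continuous partial derivatives imply differentiability *)

Lemma is_derive_line {R : realType} {V W : normedModType R} (f : V -> W) (a v : V) (t : R) :
  derivable f (a + t *: v) v ->
  is_derive t 1 (fun s => f (a + s *: v)) ('D_v f (a + t *: v)).
Proof.
have E : (fun h : R => h^-1 *: (((fun s => f (a + s *: v)) \o shift t) (h *: 1) -
    f (a + t *: v))) =
    (fun h => h^-1 *: ((f \o shift (a + t *: v)) (h *: v) - f (a + t *: v))).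
  apply/funext => h /=; congr (_ *: (f _ - _)).
  by rewrite [h%:A]mulr1 scalerDl addrCA.
by move=> df; split; rewrite /derivable /derive E.
Qed.

(** The mean value theorem gives [f a - f 0 = a * df t] for some [t] between 0 and [a]. Conditions
    are put on [|t| <= |a|] so that the increment [a], later a matrix entry, may have either
    sign. *)
Lemma MVT_linear_bound {R : realType} (f df : R -> R) (a c e : R) :
  (forall t : R, `|t| <= `|a| -> is_derive t 1 f (df t)) ->
  (forall t, `|t| <= `|a| -> `|df t - c| <= e) ->
  `|f a - f 0 - a * c| <= e * `|a|.
Proof.
move=> fdf dfc.
have seg x y : x <= y -> (forall t, x <= t <= y -> `|t| <= `|a|) ->
    exists2 t, `|t| <= `|a| & f y - f x = df t * (y - x).
  move=> xy sub; have := @MVT_segment R f df x y xy.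
  case=> [t|t|t txy ->].
  - by rewrite in_itv/= => /andP[xt ty]; apply/fdf/sub; rewrite !ltW.
  - apply: continuous_in_subspaceT => u /set_mem /=; rewrite in_itv/= => xuy.
    have := fdf u (sub _ xuy) => -[+ _].
    by move=> /derivable1_diffP/differentiable_continuous.
  - by exists t => //; apply: sub; move: txy; rewrite in_itv.
have [a0|a0] := leP 0 a.
  have [t|t ta ->] := seg 0 a a0.
    by case/andP => t0 ta; rewrite !ger0_norm.
  by rewrite subr0 [a * c]mulrC -mulrBl normrM ler_wpM2r// dfc.
have [t|t ta fE] := seg a 0 (ltW a0).
  by case/andP => ta t0; rewrite !ler0_norm ?lerN2// ltW.
have -> : f a - f 0 - a * c = a * (df t - c).
  by rewrite -[f a - f 0]opprB fE sub0r mulrN opprK mulrBr [a * df t]mulrC.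
by rewrite normrM mulrC ler_wpM2r// dfc.
Qed.

Section partial_derivatives.
Context {R : realType} {m n : nat}.
Implicit Types (f : 'M[R]_(m, n) -> R) (A H v : 'M[R]_(m, n)).
Let E (p : 'I_m * 'I_n) : 'M[R]_(m, n) := delta_mx p.1 p.2.

Lemma norm_delta_mx_le1 i j : `|delta_mx i j : 'M[R]_(m, n)| <= 1.
Proof.
rewrite [leLHS]/Num.Def.normr/= mx_normrE (bigmax_le _ ler01)//= => k _.
by rewrite mxE; case: (_ && _); rewrite ?normr1 ?normr0.
Qed.

(** In the maximum norm each summand has norm at most [|H|]. This keeps the intermediate points of a
    coordinate-by-coordinate path close to its start. *)
Lemma norm_partial_expansion_le H (s : seq ('I_m * 'I_n)) :
  `|\sum_(p <- s) H p.1 p.2 *: E p| <= (size s)%:R * `|H|.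
Proof.
elim: s => [|p s IHs]; first by rewrite big_nil normr0 mul0r.
rewrite big_cons /= -natr1 mulrDl mul1r addrC (le_trans (ler_normD _ _))//.
rewrite lerD// normrZ (le_trans (ler_piMr _ (norm_delta_mx_le1 _ _)))//.
exact: mx_entry_le_norm.
Qed.

(* Moving one coordinate at a time reduces the increment of [f] to the
   one-dimensional mean value theorem. *)
Lemma partial_expansion_near f A (s : seq ('I_m * 'I_n)) (e : R) :
  (\forall B \near A, forall i j, derivable f B (delta_mx i j)) ->
  (forall i j, {for A, continuous ('D_(delta_mx i j) f)}) -> 0 < e ->
  \forall H \near (0 : 'M[R]_(m, n)),
    `|f (A + \sum_(p <- s) (H : 'M[R]_(m, n)) p.1 p.2 *: E p) - f A
      - \sum_(p <- s) H p.1 p.2 * 'D_(E p) f A| <= e * `|H|.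
Proof.
move=> df cdf; elim: s e => [|p s IHs] e e0.
  by near=> H; rewrite !big_nil addr0 subrr subr0 normr0 mulr_ge0// ltW.
(* One half of [e] pays for the move along [E p], the other half for the moves along [s]. *)
have e20 : 0 < e / 2 by rewrite divr_gt0.
have near_p : \forall B \near A, derivable f B (E p) /\
    `|'D_(E p) f B - 'D_(E p) f A| <= e / 2.
  near=> B; split; first by apply: (near df B).
  rewrite distrC; near: B.
  by have /cvgrPdist_le := cdf p.1 p.2; apply.
have /nbhs_ballP[r /= r0 rP] := near_p.
near=> H.
have : `|f (A + \sum_(q <- s) H q.1 q.2 *: E q) - f A
    - \sum_(q <- s) H q.1 q.2 * 'D_(E q) f A| <= e / 2 * `|H|.
  by near: H; exact: IHs.
(* The path makes [size s + 1] coordinate moves, each of norm at most [|H|], so this radius keeps it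
   inside the ball of radius [r]. *)
have Hr : `|H| < r / (size s).+1%:R.
  near: H; apply/nbhs_ballP; exists (r / (size s).+1%:R); rewrite /= ?divr_gt0 ?ltr0n//.
  by move=> B; rewrite -ball_normE /= sub0r normrN.
rewrite !big_cons addrA; set S := \sum_(q <- s) _ *: _; set L := \sum_(q <- s) _ * _.
set a := H p.1 p.2 => IH.
have aH : `|a| <= `|H| by exact: mx_entry_le_norm.
have line : forall t, `|t| <= `|a| -> ball A r (A + S + t *: E p).
  move=> t ta; rewrite -ball_normE /= -addrA opprD addNKr normrN.
  have : `|S + t *: E p| <= (size s).+1%:R * `|H|.
    rewrite (le_trans (ler_normD _ _))// -natr1 mulrDl mul1r lerD//.
      exact: norm_partial_expansion_le.
    rewrite normrZ (le_trans (ler_piMr _ (norm_delta_mx_le1 _ _)))//.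
    exact: le_trans ta aH.
  by move=> /le_lt_trans; apply; rewrite mulrC -ltr_pdivlMr ?ltr0n.
have := @MVT_linear_bound R (fun t => f (A + S + t *: E p))
  (fun t => 'D_(E p) f (A + S + t *: E p)) a ('D_(E p) f A) (e / 2).
rewrite scale0r addr0 => MVT.
have {}MVT := MVT (fun t ta => is_derive_line (rP _ (line t ta)).1)
  (fun t ta => (rP _ (line t ta)).2).
have -> : f (A + a *: E p + S) - f A - (a * 'D_(E p) f A + L) =
    (f (A + S + a *: E p) - f (A + S) - a * 'D_(E p) f A) + (f (A + S) - f A - L).
  rewrite [A + a *: _ + S]addrAC; ring.
rewrite (le_trans (ler_normD _ _))// [e in leRHS]splitr mulrDl lerD//.
by rewrite (le_trans MVT)// ler_wpM2l// ltW.
Unshelve. all: by end_near. Qed.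

(** The linear form built from the partial derivatives is the differential: the little-o estimate is
    the coordinatewise expansion taken over all index pairs. [C2on] speaks only of derivatives along
    the matrices [delta_mx i j], and the chain rule along rotations needs this stronger notion. *)
Lemma continuous_partials_differentiable f A :
  (\forall B \near A, forall i j, derivable f B (delta_mx i j)) ->
  (forall i j, {for A, continuous ('D_(delta_mx i j) f)}) ->
  differentiable f A.
Proof.
move=> df cdf.
pose l H : R^o := \sum_p H p.1 p.2 * 'D_(E p) f A.
have l_lin : linear l.
  move=> k u v; rewrite /l /GRing.scale/= mulr_sumr -big_split; apply: eq_bigr => p _ /=.
  by rewrite !mxE mulrDl mulrA.
pose L : {linear 'M[R]_(m, n) -> R^o} := HB.pack l (GRing.isLinear.Build _ _ _ _ _ l_lin).
have cL : continuous L.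
  move=> B; apply: continuous_at_sum => p; apply: continuousM.
    exact: coord_continuous.
  exact: cst_continuous.
have fL : f \o shift A = cst (f A : R^o) + L +o_ (0 : 'M[R]_(m, n)) id.
  apply/eqaddoP => e e0; near=> H.
  suff: `|f (H + A) - (f A + l H)| <= e * `|H| by [].
  rewrite [H + A]addrC opprD addrA {1}[H]matrix_sum_delta pair_big /=.
  near: H; exact: partial_expansion_near.
by apply/diff_locallyP; rewrite (diff_unique cL fL).
Unshelve. all: by end_near. Qed.

Lemma derive_partials f A v : differentiable f A ->
  'D_v f A = \sum_i \sum_j v i j * 'D_(delta_mx i j) f A.
Proof.
move=> df; rewrite deriveE// {1}[v]matrix_sum_delta linear_sum.
apply: eq_bigr => i _; rewrite linear_sum; apply: eq_bigr => j _.
by rewrite linearZ /= deriveE.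
Qed.

End partial_derivatives.

Lemma is_derive_comp_diff {R : realType} {V W : normedModType R} (F : V -> W)
    (u : R -> V) (t : R) (du : V) :
  is_derive t 1 u du -> differentiable F (u t) ->
  is_derive t 1 (F \o u) ('D_du F (u t)).
Proof.
move=> [/derivable1_diffP u_diff u_du] dF.
have dFu : differentiable (F \o u) t by exact: differentiable_comp.
split; first exact: diff_derivable.
by rewrite deriveE// diff_comp//= -[X in 'd F _ X]deriveE// u_du -deriveE.
Qed.

(** * Rotations of a coordinate plane *)

Section plane_rotation.
Context {R : realType} {N : nat}.
Variables i j : 'I_N.

Definition skew_delta : 'M[R]_N := delta_mx i j - delta_mx j i.

Definition plane_proj : 'M[R]_N := delta_mx i i + delta_mx j j.

(** For [i != j] this is the exponential of [t X] with [X = skew_delta]: since [X] squares to minus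
    the projection [P = plane_proj] and [P X = X P = X], the series collapses to a cosine and a
    sine. *)
Definition plane_rot (t : R) : 'M[R]_N :=
  1%:M + (cos t - 1) *: plane_proj + sin t *: skew_delta.

Local Notation X := skew_delta.
Local Notation P := plane_proj.
Local Notation U := plane_rot.

Lemma plane_rot0 : U 0 = 1%:M.
Proof. by rewrite /plane_rot cos0 sin0 subrr !scale0r !addr0. Qed.

Lemma trmx_plane_rot t : (U t)^T = U (- t).
Proof.
rewrite /plane_rot cosN sinN !linearD !linearZ /= tr_scalar_mx /skew_delta.
rewrite !linearN /= !trmx_delta -!scalerDr; congr (_ + _).
by rewrite !scaleNr opprK addrC.
Qed.

Hypothesis ij : i != j.

Let mulPP : P *m P = P.
Proof.
rewrite /plane_proj mulmxDl !mulmxDr !mul_delta_mx_cond !eqxx (negbTE ij).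
by rewrite eq_sym (negbTE ij) !mulr0n !mulr1n addr0 add0r.
Qed.

Let mulPX : P *m X = X.
Proof.
rewrite /plane_proj /skew_delta mulmxDl !mulmxBr !mul_delta_mx_cond !eqxx (negbTE ij).
by rewrite eq_sym (negbTE ij) !mulr0n !mulr1n subr0 sub0r.
Qed.

Let mulXP : X *m P = X.
Proof.
rewrite /plane_proj /skew_delta mulmxBl !mulmxDr !mul_delta_mx_cond !eqxx (negbTE ij).
by rewrite eq_sym (negbTE ij) !mulr0n !mulr1n addr0 add0r.
Qed.

Let mulXX : X *m X = - P.
Proof.
rewrite /plane_proj /skew_delta mulmxBl !mulmxBr !mul_delta_mx_cond !eqxx (negbTE ij).
by rewrite eq_sym (negbTE ij) !mulr0n !mulr1n subr0 sub0r opprD addrC.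
Qed.

(** The multiplication table of [P] and [X] reduces this to the addition formulas for cosine and
    sine. *)
Lemma plane_rotD s t : U (s + t) = U s *m U t.
Proof.
rewrite /plane_rot !mulmxDl !mulmxDr !mul1mx !mulmx1 -!scalemxAl -!scalemxAr.
rewrite mulPP mulPX mulXP mulXX cosD sinD.
by apply/matrixP => k l; rewrite !mxE; ring.
Qed.

Lemma plane_rot_SO t : SOset (U t).
Proof.
have UtU s : (U s)^T *m U s = 1%:M.
  by rewrite trmx_plane_rot -plane_rotD addNr plane_rot0.
(* Orthogonality alone leaves the determinant equal to 1 or -1. Halving the angle makes it the
   square of [\det (U (t / 2))], which equals the determinant of [(U (t / 2))^T *m U (t / 2)], that
   is 1. *)
split=> //; rewrite [t]splitr plane_rotD det_mulmx.
by rewrite -{1}det_tr -det_mulmx UtU det1.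
Qed.

Lemma is_derive_plane_rot {p : nat} (A : 'M[R]_(N, p)) (t : R) :
  is_derive t 1 (fun s => U s *m A) (X *m (U t *m A)).
Proof.
have XUt : X *m U t = - sin t *: P + cos t *: X.
  rewrite /plane_rot !mulmxDr mulmx1 -!scalemxAr mulXP mulXX.
  by apply/matrixP => k l; rewrite !mxE; ring.
have XU : X *m (U t *m A) = - sin t *: (P *m A) + cos t *: (X *m A).
  by rewrite mulmxA XUt mulmxDl -!scalemxAl.
(* Each entry of [U s *m A] is an affine combination of [cos s] and [sin s], so the matrix
   derivative is computed entrywise. *)
have entry k l : is_derive t 1 (fun s => (U s *m A) k l) ((X *m (U t *m A)) k l).
  have : is_derive t 1 (cst (A k l) + (P *m A) k l *: (@cos R - cst 1)
      + (X *m A) k l *: @sin R)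
    (0 + (P *m A) k l *: (- sin t - 0) + (X *m A) k l *: cos t).
    exact: is_deriveD.
  rewrite (_ : _ + _ = fun s => (U s *m A) k l).
    move=> dk; rewrite XU mxE [(_ *: (P *m A)) k l]mxE [(_ *: (X *m A)) k l]mxE.
    by apply: is_derive_eq dk _; rewrite /GRing.scale/=; ring.
  apply/funext => s.
  have -> : U s *m A = A + (cos s - 1) *: (P *m A) + sin s *: (X *m A).
    by rewrite /plane_rot mulmxDl (mulmxDl 1%:M) mul1mx -!scalemxAl.
  rewrite [RHS]mxE [(A + _) k l]mxE [(_ *: (P *m A)) k l]mxE [(_ *: (X *m A)) k l]mxE.
  by rewrite [(cos s - 1) * _]mulrC [sin s * _]mulrC.
have dU : derivable (fun s => U s *m A) t 1.
  by apply/derivable_mxP => k l; have [] := entry k l.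
split=> //; rewrite derive_mx//; apply/matrixP => k l; rewrite mxE.
by have [] := entry k l.
Qed.

End plane_rotation.

(** * Infinitesimal form of the invariance of Haar measure *)

Lemma cvg_harmonic_dnbhs {R : realType} : @harmonic R @ \oo --> (0 : R)^'.
Proof.
move=> S S0; have : \forall n \near \oo, @harmonic R n != 0 -> S (harmonic n).
  exact: cvg_harmonic S0.
apply: (@filterS _ \oo _ (fun n => _)) => n; apply.
by rewrite /harmonic /= invr_eq0 pnatr_eq0.
Qed.

Section invariance.
Context {R : realType} {N : nat} {d : measure_display} {T : measurableType d}.
Variables (P : probability T R) (Q : T -> 'M[R]_N).
Hypothesis haarQ : haar_SO P Q.

Let mQ : forall i j, measurable_fun setT (fun w => Q w i j) := haarQ.1.
Let SOQ : forall w, SOset (Q w) := haarQ.2.1.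

(** Both [Q w] and [U *m Q w] lie in [SO(N)], where [F] agrees with a globally continuous function,
    to which the defining invariance applies. *)
Lemma haar_translate (F : 'M[R]_N -> R) (U : 'M[R]_N) :
  {within @SOset R N, continuous F} -> SOset U ->
  (\int[P]_w (F (U *m Q w))%:E = \int[P]_w (F (Q w))%:E)%E.
Proof.
move=> cF SOU; have [h ch Fh] := SO_extension cF.
transitivity (\int[P]_w (h (U *m Q w))%:E)%E.
  by apply: eq_integral => w _; rewrite Fh//; exact: SO_mulmx.
by rewrite haarQ.2.2//; apply: eq_integral => w _; rewrite Fh.
Qed.

Lemma SO_translate_continuous (F : 'M[R]_N -> R) (U : 'M[R]_N) :
  {within @SOset R N, continuous F} -> SOset U ->
  {within @SOset R N, continuous (fun A => F (U *m A))}.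
Proof.
move=> cF SOU; have [h ch Fh] := SO_extension cF.
apply: (@subspace_eq_continuous _ _ _ (h \o mulmx U)); last first.
  apply: continuous_subspaceT => A; apply: continuous_comp; last exact: ch.
  exact: mulmx_continuous.
move=> A /set_mem SOA; rewrite -[RHS]/(F (U *m A)) Fh//; exact: SO_mulmx.
Qed.

(** The mean of [F (U t *m Q)] does not depend on [t], so its derivative at 0 vanishes; dominated
    convergence moves this derivative inside the integral. *)
Lemma haar_integral_derive_rot0 (i j : 'I_N) (F : 'M[R]_N -> R) : i != j ->
  (forall A, SOset A -> differentiable F A) ->
  {within @SOset R N, continuous (fun A => 'D_(skew_delta i j *m A) F A)} ->
  (\int[P]_w ('D_(skew_delta i j *m Q w) F (Q w))%:E = 0)%E.
Proof.
move=> ij dF cG; set G := (fun A => _) in cG.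
pose U := @plane_rot R N i j.
have cF : {within @SOset R N, continuous F}.
  apply: continuous_in_subspaceT => A /set_mem SOA.
  exact/differentiable_continuous/dF.
(* The derivative is needed at every angle [t], not only at 0, for the mean value bound below. *)
have dFU A (t : R) : SOset A -> is_derive t 1 (fun s => F (U s *m A)) (G (U t *m A)).
  move=> SOA; have SOUA : SOset (U t *m A).
    by apply: SO_mulmx => //; exact: plane_rot_SO.
  exact: (is_derive_comp_diff (is_derive_plane_rot ij A t) (dF _ SOUA)).
(* Difference quotient at the angle [1 / (n + 1)], which is never 0. *)
pose f n w : R := n.+1%:R * (F (U n.+1%:R^-1 *m Q w) - F (Q w)).
have cf n : {within @SOset R N, continuous (fun A => F (U n.+1%:R^-1 *m A))}.
  by apply: SO_translate_continuous => //; exact: plane_rot_SO.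
have iF : P.-integrable setT (fun w => (F (Q w))%:E) by exact: SO_random_integrable.
have iFU n : P.-integrable setT (fun w => (F (U n.+1%:R^-1 *m Q w))%:E).
  exact: (SO_random_integrable P mQ SOQ (cf n)).
have ifn n : P.-integrable setT (EFin \o f n).
  apply: (@eq_integrable _ _ _ P setT measurableT
    (fun w => n.+1%:R%:E * ((F (U n.+1%:R^-1 *m Q w))%:E - (F (Q w))%:E))%E) => //.
  by apply: integrableZl => //; exact: integrableB.
have intf n : (\int[P]_w (f n w)%:E = 0)%E.
  rewrite (eq_integral
    (fun w => n.+1%:R%:E * ((F (U n.+1%:R^-1 *m Q w))%:E - (F (Q w))%:E))%E)//.
  rewrite integralZl//; last exact: integrableB.
  have FUE := haar_translate cF (plane_rot_SO ij n.+1%:R^-1).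
  rewrite (integralB_EFin measurableT (iFU n) iF) [X in (_ * (X - _))%E]FUE.
  by rewrite subee ?mule0//; exact: integrable_fin_num.
(* The difference quotients [f n] have mean 0, and the mean value theorem along
   the rotations bounds them by [sup |G|]. *)
have [M M0 GM] := SO_bounded cG.
have fM n w : `|f n w| <= M.
  have := @MVT_segment R (fun s => F (U s *m Q w)) (fun t => G (U t *m Q w)) 0 n.+1%:R^-1.
  case=> [|t _||c _].
  - by rewrite invr_ge0.
  - exact: dFU.
  - apply: continuous_subspaceT => s.
    have [+ _] := dFU (Q w) s (SOQ w).
    by move=> /derivable1_diffP/differentiable_continuous.
  rewrite /U plane_rot0 mul1mx subr0 => FE.
  rewrite /f FE mulrCA divff ?mulr1 ?pnatr_eq0// GM//.
  by apply: SO_mulmx => //; exact: plane_rot_SO.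
have fG w : f n w @[n --> \oo] --> G (Q w).
  have [dU Ud] := dFU (Q w) 0 (SOQ w).
  have : (fun h : R => h^-1 *: (((fun s => F (U s *m Q w)) \o shift 0) (h *: 1)
      - F (U 0 *m Q w))) @ 0^' --> G (Q w).
    have -> : G (Q w) = G (U 0 *m Q w) by rewrite /U plane_rot0 mul1mx.
    by rewrite -Ud; exact: dU.
  (* Dominated convergence concerns sequences, so the limit at 0 is restricted to the angles
     [1 / (n + 1)]. *)
  move=> /(cvg_comp _ _ cvg_harmonic_dnbhs).
  rewrite (_ : _ \o _ = f ^~ w)//; apply/funext => n.
  by rewrite /= /harmonic /= invrK addr0 /GRing.scale /= mulr1 /U plane_rot0 mul1mx.
have [] := @dominated_convergence _ _ _ P setT measurableT (fun n => EFin \o f n)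
  (fun w => (G (Q w))%:E) (fun=> M%:E).
- by move=> n; exact: measurable_int (ifn n).
- exact: measurable_int (SO_random_integrable P mQ SOQ cG).
- by apply: aeW => w _; apply: cvg_EFin; [exact: nearW|exact: fG].
- exact: finite_measure_integrable_cst.
- by apply: aeW => w n _; rewrite /= lee_fin.
move=> _ _; rewrite (_ : [sequence _]_n = fun=> 0%E); last first.
  by apply/funext => n; exact: intf.
by move=> /cvg_lim <-//; rewrite lim_cst.
Qed.

End invariance.

(** * Regularity of twice continuously differentiable functions *)

Lemma SO_continuous_within {R : realType} {N : nat} (F : 'M[R]_N -> R) :
  (forall A, SOset A -> {for A, continuous F}) -> {within @SOset R N, continuous F}.
Proof. by move=> cF; apply: continuous_in_subspaceT => A /set_mem; exact: cF. Qed.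

Lemma is_derive_coord {R : realType} {m n : nat} (A v : 'M[R]_(m, n)) i j :
  is_derive A v (fun B : 'M[R]_(m, n) => B i j) (v i j).
Proof.
split; first exact/diff_derivable/differentiable_coord.
have /matrixP/(_ i j) := derive_mx (@derivable_id _ _ A v).
by rewrite derive_id mxE.
Qed.

Section smooth.
Context {R : realType} {N : nat}.
Variables (D : set 'M[R]_N) (f : 'M[R]_N -> R).
Hypotheses (oD : open D) (hf : C2on D f).

(** Openness of [D] turns the existence of partial derivatives on [D] into existence near [A]. *)
Lemma C2on_differentiable A : D A -> differentiable f A.
Proof.
move=> DA; apply: continuous_partials_differentiable => [|i k].
  apply: filterS (open_nbhs_nbhs (conj oD DA)) => B DB i k; exact: hf.2.1.
exact: hf.2.2.1.
Qed.

Lemma C2on_pderiv_differentiable i k A : D A -> differentiable (pderiv f i k) A.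
Proof.
move=> DA; apply: continuous_partials_differentiable => [|j l].
  apply: filterS (open_nbhs_nbhs (conj oD DA)) => B DB j l; exact: hf.2.2.2.1.
exact: hf.2.2.2.2.
Qed.

End smooth.

(** * Algebra of the rotation fields *)

Section rotation_field.
Context {R : realType} {N : nat}.
Implicit Types (f g : 'M[R]_N -> R) (A : 'M[R]_N).

(** The operator [L_ij] in coordinates: multiplication by [skew_delta i j] puts row [j] of [A] in
    row [i], minus row [i] in row [j], and zero elsewhere when [i != j]. *)
Definition rot_field (i j : 'I_N) f A : R :=
  \sum_k (A j k * pderiv f i k A - A i k * pderiv f j k A).

Lemma skew_delta_mul (i j : 'I_N) A a k :
  (skew_delta i j *m A) a k = (a == i)%:R * A j k - (a == j)%:R * A i k.
Proof.
rewrite /skew_delta mulmxBl mxE [X in _ + X]mxE !mxE.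
rewrite (bigD1 j)//= big1 => [|l lj]; last by rewrite mxE (negbTE lj) andbF mul0r.
rewrite (bigD1 i)//= [X in _ - (_ + X)]big1 => [|l li].
  by rewrite !mxE !eqxx !andbT !addr0.
by rewrite mxE (negbTE li) andbF mul0r.
Qed.

Lemma derive_rot_field (i j : 'I_N) f A : differentiable f A ->
  'D_(skew_delta i j *m A) f A = rot_field i j f A.
Proof.
move=> df; rewrite derive_partials// exchange_big; apply: eq_bigr => k _ /=.
under eq_bigr do rewrite skew_delta_mul mulrBl.
rewrite sumrB (bigD1 i)//= big1 => [|a ai]; last by rewrite (negbTE ai) !mul0r.
rewrite (bigD1 j)//= [X in _ - (_ + X)]big1 => [|a aj].
  by rewrite !eqxx !mul1r !addr0.
by rewrite (negbTE aj) !mul0r.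
Qed.

(* [t i k a l] stands for a second-order derivative in the entries [(i, k)] and
   [(a, l)], contracted with the coefficients of [L_ij] in both slots. *)
Definition skew_contraction (t : 'I_N -> 'I_N -> 'I_N -> 'I_N -> R) A (i j : 'I_N) : R :=
  \sum_k \sum_l (A j k * A j l * t i k i l - A j k * A i l * t i k j l
    - A i k * A j l * t j k i l + A i k * A i l * t j k j l).

(** Exchanging [i] and [j] pairs the four terms into two equal pairs, whence the factor 2. In the
    square terms the sum over [j] of [A j k * A j l] is 1 if [k = l] and 0 otherwise, because the
    columns are orthonormal. *)
Lemma sum_skew_contraction t A : SOset A ->
  \sum_i \sum_j skew_contraction t A i j =
  2 * (\sum_i \sum_k t i k i k
       - \sum_i \sum_j \sum_k \sum_l A j k * A i l * t i k j l).
Proof.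
case=> /matrixP AA _.
pose S i j := \sum_k \sum_l A j k * A j l * t i k i l.
pose V i j := \sum_k \sum_l A j k * A i l * t i k j l.
have -> : \sum_i \sum_j skew_contraction t A i j =
    \sum_i \sum_j (S i j - V i j - V j i + S j i).
  apply: eq_bigr => i _; apply: eq_bigr => j _.
  by rewrite /S /V -!sumrB -big_split; apply: eq_bigr => k _; rewrite -!sumrB -big_split.
have -> : \sum_i \sum_k t i k i k = \sum_i \sum_j S i j.
  apply: eq_bigr => i _; rewrite /S exchange_big; apply: eq_bigr => k _ /=.
  rewrite exchange_big /= (bigD1 k)//= [X in _ + X]big1 => [|l lk].
    rewrite addr0 -mulr_suml; have := AA k k; rewrite !mxE eqxx.
    under eq_bigr do rewrite mxE.
    by move=> ->; rewrite mul1r.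
  rewrite -mulr_suml; have := AA k l; rewrite !mxE eq_sym (negbTE lk).
  under eq_bigr do rewrite mxE.
  by move=> ->; rewrite mul0r.
have split4 : \sum_i \sum_j (S i j - V i j - V j i + S j i) =
    \sum_i \sum_j S i j - \sum_i \sum_j V i j - \sum_i \sum_j V j i
    + \sum_i \sum_j S j i.
  by rewrite -!sumrB -big_split; apply: eq_bigr => i _; rewrite -!sumrB -big_split.
rewrite split4 [\sum_i \sum_j V j i]exchange_big [\sum_i \sum_j S j i]exchange_big /=.
by rewrite /V; ring.
Qed.

Lemma skew_contraction_diag t A i : skew_contraction t A i i = 0.
Proof. by apply: big1 => k _; apply: big1 => l _; ring. Qed.

(** With first derivatives for [p] and [r] and second derivatives for [h], the right-hand side is
    the product of two rotation fields plus [c] times an iterated field whose coefficients are not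
    differentiated. *)
Lemma skew_contraction_product (p r : 'I_N -> 'I_N -> R)
    (h : 'I_N -> 'I_N -> 'I_N -> 'I_N -> R) (c : R) A i j :
  skew_contraction (fun a k b l => p a k * r b l + c * h a k b l) A i j =
  (\sum_k (A j k * p i k - A i k * p j k)) * (\sum_k (A j k * r i k - A i k * r j k))
  + c * \sum_k (A j k * (\sum_l (A j l * h i k i l - A i l * h i k j l))
               - A i k * (\sum_l (A j l * h j k i l - A i l * h j k j l))).
Proof.
rewrite big_distrlr mulr_sumr -big_split; apply: eq_bigr => k _ /=.
rewrite !mulr_sumr -sumrB mulr_sumr -big_split; apply: eq_bigr => l _ /=.
by ring.
Qed.

(** Each index occurs in [N - 1] ordered off-diagonal pairs as first member and in as many as second
    member. *)
Lemma sum_offdiag (e : 'I_N -> R) :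
  \sum_i \sum_(j | i != j) (e i + e j) = 2 * (N%:R - 1) * \sum_i e i.
Proof.
have row i : \sum_(j | i != j) (e i + e j) = N%:R * e i + \sum_j e j - 2 * e i.
  have : \sum_j (e i + e j) = (e i + e i) + \sum_(j | i != j) (e i + e j).
    by rewrite (bigD1 i)//=; congr (_ + _); apply: eq_bigl => j; rewrite eq_sym.
  rewrite big_split sumr_const card_ord /= -mulr_natl => rowE.
  by apply: (addrI (e i + e i)); rewrite -rowE; ring.
under eq_bigr do rewrite row.
by rewrite sumrB big_split -!mulr_sumr sumr_const card_ord /= -mulr_natl; ring.
Qed.

End rotation_field.

(** * The product rule for [g * L_ij f] *)

Section integrand.
Context {R : realType} {N : nat}.
Variables (D : set 'M[R]_N) (f g : 'M[R]_N -> R).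
Hypotheses (oD : open D) (hf : C2on D f) (hg : C2on D g).
Implicit Type A : 'M[R]_N.

(** The derivative in the entry [(a, l)] of [g] times the partial derivative of [f] in the entry
    [(i, k)]. *)
Definition product_tensor A (i k a l : 'I_N) : R :=
  pderiv f i k A * pderiv g a l A + g A * pderiv (pderiv f i k) a l A.

Lemma is_derive_rot_field (i j : 'I_N) A v : D A ->
  is_derive A v (rot_field i j f)
    (\sum_k (A j k * 'D_v (pderiv f i k) A + pderiv f i k A * v j k
           - (A i k * 'D_v (pderiv f j k) A + pderiv f j k A * v i k))).
Proof.
move=> DA; pose c a k := fun B : 'M[R]_N => B a k.
have dp a k : is_derive A v (pderiv f a k) ('D_v (pderiv f a k) A).
  exact/derivableP/diff_derivable/(C2on_pderiv_differentiable oD hf).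
have dc a k : is_derive A v (c a k) (v a k) by exact: is_derive_coord.
have -> : rot_field i j f =
    \sum_k (c j k * pderiv f i k - c i k * pderiv f j k).
  by apply/funext => B; rewrite fct_sumE.
apply: is_derive_sum => k; apply: is_deriveB; exact: is_deriveM.
Qed.

(** Besides the terms with two derivatives, the product rule differentiates the coefficients of
    [L_ij]. Along [v = X A] one has [v j k = - A i k] and [v i k = A j k], so both coefficients
    contribute with a minus sign. *)
Lemma derive_mul_rot_field (i j : 'I_N) A : i != j -> D A ->
  'D_(skew_delta i j *m A) (g * rot_field i j f) A =
  skew_contraction (product_tensor A) A i j
  - g A * \sum_k (A i k * pderiv f i k A + A j k * pderiv f j k A).
Proof.
move=> ij DA; set v := _ *m A.
have dg : differentiable g A by exact: C2on_differentiable hg _ DA.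
have df : differentiable f A by exact: C2on_differentiable hf _ DA.
have [dL DL] := is_derive_rot_field i j v DA.
rewrite deriveM//; last exact: diff_derivable.
rewrite DL [in X in _ + X](derive_rot_field _ _ dg) /GRing.scale /=.
have vj k : v j k = - A i k.
  by rewrite skew_delta_mul eqxx eq_sym (negbTE ij) mul0r mul1r sub0r.
have vi k : v i k = A j k.
  by rewrite skew_delta_mul eqxx (negbTE ij) mul0r mul1r subr0.
have dp a k : 'D_v (pderiv f a k) A = rot_field i j (pderiv f a k) A.
  exact/derive_rot_field/(C2on_pderiv_differentiable oD hf).
under eq_bigr do rewrite vj vi !dp.
have -> : skew_contraction (product_tensor A) A i j =
    rot_field i j f A * rot_field i j g A
    + g A * \sum_k (A j k * rot_field i j (pderiv f i k) A
                  - A i k * rot_field i j (pderiv f j k) A).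
  exact: (skew_contraction_product (fun a k => pderiv f a k A)
    (fun a k => pderiv g a k A) (fun a k b l => pderiv (pderiv f a k) b l A)).
have alg (a b x y z w : R) :
  a * x + z * - b - (b * y + w * a) = a * x - b * y - (b * z + a * w) by ring.
rewrite addrC -addrA -mulrBr -sumrB; congr (_ + _ * _).
by apply: eq_bigr => k _; rewrite alg.
Qed.

Lemma mul_rot_field_differentiable (i j : 'I_N) A : D A ->
  differentiable (g * rot_field i j f) A.
Proof.
move=> DA; apply: differentiableM; first exact: C2on_differentiable hg _ DA.
rewrite (_ : rot_field i j f = \sum_k ((fun B : 'M[R]_N => B j k) * pderiv f i k
    - (fun B : 'M[R]_N => B i k) * pderiv f j k)); last first.
  by apply/funext => B; rewrite fct_sumE.
apply: differentiable_sum => k; apply: differentiableB; apply: differentiableM;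
  do ?exact: differentiable_coord; exact: C2on_pderiv_differentiable hf _ _ _ DA.
Qed.

End integrand.

(** * Summation over all coordinate planes *)

Section rot_integrand.
Context {R : realType} {N : nat}.
Variables (D : set 'M[R]_N) (f g : 'M[R]_N -> R).
Hypotheses (oD : open D) (hf : C2on D f) (hg : C2on D g).
Implicit Type A : 'M[R]_N.

(** Explicit form of the derivative of [g * L_ij f] for [i != j], from which continuity can be read
    off. *)
Definition rot_integrand (i j : 'I_N) A : R :=
  skew_contraction (product_tensor f g A) A i j
  - g A * \sum_k (A i k * pderiv f i k A + A j k * pderiv f j k A).

Definition first_order_term A : R :=
  \sum_i \sum_k A i k * pderiv f i k A * g A.

(** The bracket on the right-hand side of the theorem, grouped into one tensor so as to match the
    contracted sum. *)
Definition second_order_term A : R :=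
  \sum_i \sum_k product_tensor f g A i k i k
  - \sum_i \sum_j \sum_k \sum_l A j k * A i l * product_tensor f g A i k j l.

Lemma second_order_termE A :
  second_order_term A =
  \sum_i \sum_k pderiv (pderiv f i k) i k A * g A
  - \sum_i \sum_j \sum_k \sum_l A j k * A i l * pderiv (pderiv f i k) j l A * g A
  + \sum_i \sum_k pderiv f i k A * pderiv g i k A
  - \sum_i \sum_j \sum_k \sum_l A j k * A i l * pderiv f i k A * pderiv g j l A.
Proof.
have alg (a b c e : R) : a - b + c - e = (a + c) - (b + e) by ring.
rewrite alg -!big_split; congr (_ - _).
  apply: eq_bigr => i _; rewrite -big_split; apply: eq_bigr => k _.
  by rewrite /product_tensor addrC mulrC.
apply: eq_bigr => i _; rewrite -big_split; apply: eq_bigr => j _.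
rewrite -big_split; apply: eq_bigr => k _; rewrite -big_split; apply: eq_bigr => l _.
by rewrite /product_tensor mulrDr addrC (mulrC (g A)) !mulrA.
Qed.

(** The contraction vanishes for [i = j], so its sum extends to all pairs and orthonormality
    applies; the coefficient terms are counted by [sum_offdiag]. *)
Lemma sum_rot_integrand A : SOset A ->
  \sum_i \sum_(j | i != j) rot_integrand i j A =
  2 * (second_order_term A - (N%:R - 1) * first_order_term A).
Proof.
move=> SOA; pose e i := \sum_k A i k * pderiv f i k A.
have -> : first_order_term A = g A * \sum_i e i.
  rewrite /first_order_term mulr_sumr; apply: eq_bigr => i _.
  by rewrite /e mulr_sumr; apply: eq_bigr => k _; rewrite mulrC.
have skewE : \sum_i \sum_(j | i != j) skew_contraction (product_tensor f g A) A i j =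
    \sum_i \sum_j skew_contraction (product_tensor f g A) A i j.
  apply: eq_bigr => i _; rewrite [RHS](bigD1 i)//= skew_contraction_diag add0r.
  by apply: eq_bigl => j; rewrite eq_sym.
have -> : \sum_i \sum_(j | i != j) rot_integrand i j A =
    \sum_i \sum_(j | i != j) skew_contraction (product_tensor f g A) A i j
    - g A * \sum_i \sum_(j | i != j) (e i + e j).
  rewrite mulr_sumr -sumrB; apply: eq_bigr => i _.
  rewrite mulr_sumr -sumrB; apply: eq_bigr => j _.
  by rewrite /rot_integrand big_split.
rewrite skewE sum_skew_contraction// -/(second_order_term A) sum_offdiag.
have alg (x y c n : R) : 2 * x - c * (2 * n * y) = 2 * (x - n * (c * y)) by ring.
exact: alg.
Qed.

(** * Continuity of the integrands on [D] *)

Let tensor_monomial_continuous (a k b l c c' d d' : 'I_N) A : D A ->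
  {for A, continuous (fun B : 'M[R]_N => B a k * B b l * product_tensor f g B c c' d d')}.
Proof.
move=> DA; have ct : {for A, continuous (fun B => product_tensor f g B c c' d d')}.
  apply: continuousD.
    exact: (continuousM (hf.2.2.1 c c' A DA) (hg.2.2.1 d d' A DA)).
  exact: (continuousM (hg.1 A DA) (hf.2.2.2.2 c c' d d' A DA)).
have cc := continuousM (@coord_continuous R N N a k A) (@coord_continuous R N N b l A).
exact: (continuousM cc ct).
Qed.

Let gradient_monomial_continuous (a k b : 'I_N) A : D A ->
  {for A, continuous (fun B : 'M[R]_N => B a k * pderiv f b k B)}.
Proof.
by move=> DA; exact: (continuousM (@coord_continuous R N N a k A) (hf.2.2.1 b k A DA)).
Qed.

Lemma rot_integrand_continuous i j A : D A -> {for A, continuous (rot_integrand i j)}.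
Proof.
move=> DA; have cT := fun a k b l c c' d d' =>
  @tensor_monomial_continuous a k b l c c' d d' A DA.
apply: continuousB.
  apply: continuous_at_sum => k; apply: continuous_at_sum => l.
  exact: (continuousD (continuousB (continuousB (cT _ _ _ _ _ _ _ _)
    (cT _ _ _ _ _ _ _ _)) (cT _ _ _ _ _ _ _ _)) (cT _ _ _ _ _ _ _ _)).
apply: (continuousM (hg.1 A DA)); apply: continuous_at_sum => k.
exact: (continuousD (gradient_monomial_continuous DA)
  (gradient_monomial_continuous DA)).
Qed.

Lemma first_order_term_continuous A : D A -> {for A, continuous first_order_term}.
Proof.
move=> DA; apply: continuous_at_sum => i; apply: continuous_at_sum => k.
exact: (continuousM (gradient_monomial_continuous DA) (hg.1 A DA)).
Qed.

Lemma second_order_term_continuous A : D A -> {for A, continuous second_order_term}.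
Proof.
move=> DA; apply: continuousB.
  apply: continuous_at_sum => i; apply: continuous_at_sum => k.
  apply: continuousD.
    exact: (continuousM (hf.2.2.1 i k A DA) (hg.2.2.1 i k A DA)).
  exact: (continuousM (hg.1 A DA) (hf.2.2.2.2 i k i k A DA)).
apply: continuous_at_sum => i; apply: continuous_at_sum => j.
apply: continuous_at_sum => k; apply: continuous_at_sum => l.
exact: tensor_monomial_continuous.
Qed.

End rot_integrand.

(** * Integration of the pointwise identity against the law of [Q] *)

Theorem theorem7p1 (R : realType) (N : nat) (hN : (2 <= N)%N)
  (D : set 'M[R]_N) (hDopen : open D) (hSO : @SOset R N `<=` D)
  (f g : 'M[R]_N -> R) (hf : C2on D f) (hg : C2on D g)
  (d : measure_display) (Omega : measurableType d) (P : probability Omega R)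
  (Q : Omega -> 'M[R]_N) (hQ : haar_SO P Q) :
  (\int[P]_w (\sum_(i < N) \sum_(k < N)
        Q w i k * pderiv f i k (Q w) * g (Q w))%:E
   = ((N%:R - 1)^-1)%:E *
     \int[P]_w (\sum_(i < N) \sum_(k < N)
                  pderiv (pderiv f i k) i k (Q w) * g (Q w)
              - \sum_(i < N) \sum_(j < N) \sum_(k < N) \sum_(k' < N)
                  Q w j k * Q w i k' * pderiv (pderiv f i k) j k' (Q w) * g (Q w)
              + \sum_(i < N) \sum_(k < N)
                  pderiv f i k (Q w) * pderiv g i k (Q w)
              - \sum_(i < N) \sum_(j < N) \sum_(k < N) \sum_(k' < N)
                  Q w j k * Q w i k' * pderiv f i k (Q w) * pderiv g j k' (Q w))%:E)%E.
Proof.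
have [mQ [SOQ _]] := hQ.
pose FO := first_order_term f g; pose ST := second_order_term f g.
have cG i j : {within @SOset R N, continuous (rot_integrand f g i j)}.
  by apply: SO_continuous_within => A /hSO; exact: rot_integrand_continuous.
have intG i j : i != j -> (\int[P]_w (rot_integrand f g i j (Q w))%:E = 0)%E.
  move=> ij; have GE A : SOset A ->
      'D_(skew_delta i j *m A) (g * rot_field i j f) A = rot_integrand f g i j A.
    by move=> /hSO; exact: derive_mul_rot_field.
  transitivity (\int[P]_w ('D_(skew_delta i j *m Q w) (g * rot_field i j f) (Q w))%:E)%E.
    by apply: eq_integral => w _; rewrite GE.
  apply: (haar_integral_derive_rot0 hQ ij) => [A /hSO|].
    exact: mul_rot_field_differentiable.
  (* The directional derivative inherits its continuity from the explicit formula with which it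
     agrees on [SO(N)]. *)
  apply: (@subspace_eq_continuous _ _ _ (rot_integrand f g i j)) (cG i j).
  by move=> A /set_mem SOA; rewrite -GE.
have iFO : P.-integrable setT (fun w => (FO (Q w))%:E).
  apply: SO_random_integrable => //; apply: SO_continuous_within => A /hSO.
  exact: first_order_term_continuous.
have iST : P.-integrable setT (fun w => (ST (Q w))%:E).
  apply: SO_random_integrable => //; apply: SO_continuous_within => A /hSO.
  exact: second_order_term_continuous.
have N1 : N%:R - 1 != 0 :> R by rewrite subr_eq0 pnatr_eq1 gtn_eqF.
(* The integrand is the sum of [rot_integrand] over the ordered pairs of distinct indices, and each
   summand has mean 0. *)
have int0 : (\int[P]_w (2%:E * ((ST (Q w))%:E - (N%:R - 1)%:E * (FO (Q w))%:E)) = 0)%E.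
  transitivity (\int[P]_w (\sum_(p | p.1 != p.2) (rot_integrand f g p.1 p.2 (Q w))%:E)%E)%E.
    apply: eq_integral => w _; have := sum_rot_integrand f g (SOQ w).
    by rewrite pair_big_dep /= sumEFin => ->.
  rewrite integral_sum//; first by rewrite big1// => p; exact: intG.
  by move=> p; exact: SO_random_integrable.
have fFO := integrable_fin_num measurableT iFO.
have fST := integrable_fin_num measurableT iST.
(* Both integrals are finite, so linearity leaves an equation between real numbers in which the
   factor 2 cancels. *)
have intE : (\int[P]_w (ST (Q w))%:E = (N%:R - 1)%:E * \int[P]_w (FO (Q w))%:E)%E.
  move: int0; rewrite integralZl//; last first.
    by apply: integrableB => //; exact: integrableZl.
  rewrite integralB//; last exact: integrableZl.
  rewrite integralZl// -(fineK fFO) -(fineK fST); set x := fine _; set y := fine _ => xy0.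
  have /eqP : 2 * (x - (N%:R - 1) * y) = 0 by apply: EFin_inj.
  by rewrite mulf_eq0 pnatr_eq0 /= subr_eq0 => /eqP ->.
rewrite [X in (_ * X)%E](_ : _ = \int[P]_w (ST (Q w))%:E)%E; last first.
  apply: eq_integral => w _; congr EFin.
  by rewrite -second_order_termE.
by rewrite intE muleA -EFinM mulVf// mul1e.
Qed.
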